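(* Let $K\subset\mathbb R^2$ be a closed convex set of hyperbolic type. Then for every $\mu>0$ and every $0<\varepsilon<1$ there exist a continuous function $f\colon K^c\to\mathbb R$, not identically zero, and a constant $C>0$ such that $|f(x)|\le C\exp(-\mu|x|^{1-\varepsilon})$ for all $x\in K^c$, and the classical Radon transform of $f$ vanishes on every line avoiding $K$, i.e. $\int_{l}f(x)\,dx=0$ (with respect to Lebesgue measure on $l$) for every line $l\subset K^c$.
   Context: $K^c=\mathbb R^2\setminus K$. A closed convex set $K\subset\mathbb R^2$ is of hyperbolic type if it contains two distinct half-lines with the same endpoint and it is contained in an angle, where an angle is the intersection of two half-planes with different normal vectors. *)

(* Defs.v *)
From HB Require Import structures.
From mathcomp Require Import all_boot all_order all_algebra.
From mathcomp Require Import all_classical all_reals all_analysis.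

Set Implicit Arguments.
Unset Strict Implicit.
Unset Printing Implicit Defensive.

Import Order.TTheory GRing.Theory Num.Theory.
Import numFieldNormedType.Exports.

Local Open Scope classical_set_scope.
Local Open Scope ring_scope.

(* The plane is the product R * R: its library topology is the usual one, but
   its library norm is the sup norm, whence [enorm] below. *)

Definition dot (R : realType) (x y : R * R) : R := x.1 * y.1 + x.2 * y.2.

Definition enorm (R : realType) (x : R * R) : R := Num.sqrt (dot x x).

Definition half_line (R : realType) (p u : R * R) : set (R * R) :=
  [set p + t *: u | t in [set t : R | 0 <= t]].

(* The closed half-plane with outer normal vector n, meant for n != 0. *)
Definition half_plane (R : realType) (n : R * R) (c : R) : set (R * R) :=
  [set x | dot n x <= c].

(* Normal vectors are normalized to unit length: otherwise n and 2 n would be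
   different normal vectors of a single half-plane, and every half-plane would
   be an angle. *)
Definition is_angle (R : realType) (A : set (R * R)) : Prop :=
  exists n1 n2 : R * R, exists c1 c2 : R,
    [/\ enorm n1 = 1, enorm n2 = 1, n1 != n2 &
        A = half_plane n1 c1 `&` half_plane n2 c2].

Definition hyperbolic_type (R : realType) (K : set (R * R)) : Prop :=
  (exists p u v : R * R,
     [/\ u != 0, v != 0, half_line p u <> half_line p v &
         half_line p u `|` half_line p v `<=` K]) /\
  (exists2 A : set (R * R), is_angle A & K `<=` A).

Definition line (R : realType) (p u : R * R) : set (R * R) :=
  [set p + t *: u | t in [set: R]].

(* For enorm u = 1 the parametrization t |-> p + t u is by arc length, so this
   is the integral over [line p u] for the Lebesgue measure of that line. *)
Definition line_integral (R : realType) (f : R * R -> R) (p u : R * R) : \bar R :=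
  (\int[lebesgue_measure]_(t in [set: R]) (f (p + t *: u))%:E)%E.

(* Main.v *)
(** Holomorphic functions of z = x + i y give exterior null functions: if K
   contains a sector of opening just below pi, the function exp (- M z^(1 - eps))
   decays in every direction of the complementary sector, because the opening of
   the latter times (1 - eps) is below pi.  Its derivative has the same decay and,
   by the fundamental theorem of calculus, its integral along every line in the
   complement vanishes; the real part is the desired f.  An affine change of
   coordinates turns the cone spanned by two independent half-lines of K into
   such a sector, with the apex moved inside K to keep z away from 0.  When the
   two half-lines are opposite, the lines avoiding K all have the direction u of
   these half-lines, and f z = <u, z> exp (- |z|^2) works. *)

Require Import Defs.
From HB Require Import structures.
From mathcomp Require Import all_boot all_order all_algebra.
From mathcomp Require Import all_classical all_reals all_analysis.
From mathcomp Require Import measurable_realfun ring lra.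

Set Implicit Arguments.
Unset Strict Implicit.
Unset Printing Implicit Defensive.

Import Order.TTheory GRing.Theory Num.Theory.
Import numFieldNormedType.Exports.

Local Open Scope classical_set_scope.
Local Open Scope ring_scope.

(** * Integrals of derivatives over the whole real line *)

Section ftc_real_line.
Context {R : realType}.
Local Notation mu := (@lebesgue_measure R).
Implicit Types f F : R -> R.

Lemma derivable_continuous f : (forall t, derivable f t 1) -> continuous f.
Proof.
by move=> df t; apply/differentiable_continuous/derivable1_diffP/df.
Qed.

(** The reflection t -> - t turns this into the fundamental theorem on a half-line going to +oo,
    with primitive - F (- t). *)
Lemma ge0_continuous_FTC2Ny f F (a l : R) : (forall t, 0 <= f t) ->
    continuous f -> (forall t : R, is_derive t 1 F (f t)) ->
    F t @[t --> -oo] --> l ->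
  (\int[mu]_(t in `]-oo, a]) (f t)%:E = (F a - l)%:E)%E.
Proof.
move=> f0 cf dF Fl.
have dG (t : R) : is_derive t 1 (fun s : R => - F (- s)) (f (- t)).
  have -> : f (- t) = - (f (- t) * -1) by rewrite mulrN1 opprK.
  exact: is_deriveN.
have cG : continuous (fun s => - F (- s)).
  by apply: derivable_continuous => t; exact: ex_derive.
rewrite -{1}(opprK a) ge0_integration_by_substitutionNy//; last first.
  exact: continuous_subspaceT.
rewrite (@ge0_continuous_FTC2y _ (f \o -%R) (fun s => - F (- s)) (- a) (- l))//.
- by rewrite opprK -EFinB opprK addrC.
- by move=> t _; exact: f0.
- apply: continuous_subspaceT => t; apply: continuous_comp; last exact: cf.
  exact: oppr_continuous.
- apply: cvgN; move/cvgNy_compNP : Fl; exact.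
- by apply: cvg_at_right_filter; exact: cG.
- by move=> t _; rewrite derive1E; exact: derive_val.
Qed.

Lemma ge0_continuous_FTC2T f F (l l' : R) : (forall t, 0 <= f t) ->
    continuous f -> (forall t : R, is_derive t 1 F (f t)) ->
    F t @[t --> -oo] --> l -> F t @[t --> +oo] --> l' ->
  (\int[mu]_t (f t)%:E = (l' - l)%:E)%E.
Proof.
move=> f0 cf dF Fl Fl'.
have mf (D : set R) : measurable D -> measurable_fun D f.
  by move=> mD; apply: measurable_funTS; exact: continuous_measurable_fun.
have cF : continuous F by apply: derivable_continuous => t; exact: ex_derive.
have cover : [set` `]-oo, (0 : R)]] `|` [set` `](0 : R), +oo[] = setT.
  by rewrite -setCitvl setUv.
rewrite -cover ge0_integral_setU//; last 3 first.
- by apply/measurable_EFinP; apply: mf; apply: measurableU; exact: measurable_itv.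
- by move=> t _; rewrite lee_fin.
- apply/disj_setPLR; by rewrite -setCitvl setCK.
rewrite (@ge0_continuous_FTC2Ny _ F _ l)//.
rewrite integral_itv_obnd_cbnd; last by apply/measurable_EFinP; exact: mf.
rewrite (@ge0_continuous_FTC2y _ f F 0 l')//.
- by rewrite -EFinB -EFinD; congr EFin; ring.
- exact: continuous_subspaceT.
- by apply: cvg_at_right_filter; exact: cF.
- by move=> t _; rewrite derive1E; exact: derive_val.
Qed.

Lemma cvgNy_atan : (@atan R) t @[t --> -oo] --> - (pi / 2).
Proof.
apply/cvgNy_compNP.
rewrite (_ : _ \o _ = fun t => - atan t); last by apply/funext => t; rewrite /= atanN.
by apply: cvgN; exact: cvgy_atan.
Qed.

Lemma cvgy_oneDsqrV : (oneDsqr t : R)^-1 @[t --> +oo] --> 0.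
Proof.
apply: (@squeeze_cvgr _ _ _ _ (cst 0) (fun t => t^-1)).
- near=> t.
  have t1 : 1 <= t by near: t; exact: nbhs_pinfty_ge.
  have s1 := oneDsqr_ge1 t.
  rewrite /= invr_ge0 lef_pV2 ?posrE ?(lt_le_trans ltr01)//.
  by rewrite (le_trans ler01 s1)/= /oneDsqr; nra.
- exact: cvg_cst.
- by apply/(gtr0_cvgV0 (f := id)); [exact: nbhs_pinfty_gt|exact: cvg_id].
Unshelve. all: by end_near. Qed.

Lemma cvgNy_oneDsqrV : (oneDsqr t : R)^-1 @[t --> -oo] --> 0.
Proof.
apply/cvgNy_compNP.
rewrite (_ : _ \o _ = fun t => (oneDsqr t)^-1); first exact: cvgy_oneDsqrV.
by apply/funext => t; rewrite /= /oneDsqr sqrrN.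
Qed.

(* Adding C / (1 + t^2), whose primitive is C atan, reduces this to nonnegative
   integrands. *)
Lemma integral_derive_eq0 f F (C : R) : continuous f ->
    (forall t : R, is_derive t 1 F (f t)) ->
    (forall t, `|f t| <= C / oneDsqr t) -> (forall t, `|F t| <= C / oneDsqr t) ->
  (\int[mu]_t (f t)%:E = 0)%E.
Proof.
move=> cf dF fC FC.
have C0 : 0 <= C.
  have := le_trans (normr_ge0 _) (fC 0).
  by rewrite /oneDsqr expr0n addr0 divr1.
pose h t := C / oneDsqr t; pose H t : R := C * atan t.
have dh (t : R) : is_derive t 1 H (h t).
  exact: is_deriveZ.
have h0 t : 0 <= h t by exact: le_trans (normr_ge0 _) (fC t).
have ch : continuous h.
  by move=> t; apply: cvgM; [exact: cvg_cst|exact: continuous_oneDsqrV].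
have Hy : H t @[t --> +oo] --> C * (pi / 2).
  by apply: cvgMr; exact: cvgy_atan.
have HNy : H t @[t --> -oo] --> C * - (pi / 2).
  by apply: cvgMr; exact: cvgNy_atan.
have F0 (G : set_system R) (_ : Filter G) : (oneDsqr t)^-1 @[t --> G] --> 0 ->
    F t @[t --> G] --> 0.
  move=> G0; apply/norm_cvg0P.
  apply: (@squeeze_cvgr _ _ _ _ (cst 0) h).
  - by apply: nearW => t /=; rewrite normr_ge0 FC.
  - exact: cvg_cst.
  - by rewrite -(mulr0 C); apply: cvgMr.
have Fy : F t @[t --> +oo] --> 0 by apply: F0; exact: cvgy_oneDsqrV.
have FNy : F t @[t --> -oo] --> 0 by apply: F0; exact: cvgNy_oneDsqrV.
have ih := @ge0_continuous_FTC2T h H _ _ h0 ch dh HNy Hy.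
have fh0 t : 0 <= (f \+ h) t.
  by have := fC t; rewrite ler_norml /= -/(h t) => /andP[]; lra.
have cfh : continuous (f \+ h).
  by move=> t; apply: cvgD; [exact: cf|exact: ch].
have ifh : (\int[mu]_t ((f \+ h) t)%:E = (C * (pi / 2) - C * - (pi / 2))%:E)%E.
  apply: (@ge0_continuous_FTC2T _ (F \+ H)) => //.
  - by rewrite -[X in _ --> X]add0r; exact: cvgD.
  - by rewrite -[X in _ --> X]add0r; exact: cvgD.
have int (g : R -> R) : continuous g -> (forall t, 0 <= g t) ->
    (\int[mu]_t (g t)%:E < +oo)%E -> mu.-integrable setT (EFin \o g).
  move=> cg g0 gy; apply/integrableP; split.
    by apply/measurable_EFinP; exact: continuous_measurable_fun.
  by under eq_integral => t _ do rewrite /= ger0_norm//.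
rewrite (_ : (fun t => (f t)%:E) = (EFin \o (f \+ h)%R) \- (EFin \o h))%E; last first.
  by apply/funext => t /=; rewrite -EFinB addrK.
rewrite integralB//; last 2 first.
- by apply: int => //; rewrite ifh ltry.
- by apply: int => //; rewrite ih ltry.
by rewrite /= ifh ih -EFinB; congr EFin; ring.
Qed.

End ftc_real_line.

(** * Derivation rules for real functions given as explicit lambdas *)

Section real_derivation_rules.
Context {R : realType}.
Variables (f g : R -> R) (t a b : R).
Hypotheses (df : is_derive t 1 f a) (dg : is_derive t 1 g b).

Lemma is_derive_addf : is_derive t 1 (fun s => f s + g s) (a + b).
Proof. exact: is_deriveD. Qed.

Lemma is_derive_oppf : is_derive t 1 (fun s => - f s) (- a).
Proof. exact: is_deriveN. Qed.

Lemma is_derive_mulf : is_derive t 1 (fun s => f s * g s) (f t * b + g t * a).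
Proof. exact: is_deriveM. Qed.

Lemma is_derive_scalef (k : R) : is_derive t 1 (fun s => k * f s) (k * a).
Proof. exact: is_deriveZ. Qed.

Lemma is_derive_divf : g t != 0 ->
  is_derive t 1 (fun s => f s / g s) ((a * g t - f t * b) / g t ^+ 2).
Proof.
move=> g0.
apply: (is_derive_eq (@is_deriveM _ _ _ _ _ _ _ _ df (is_deriveV g0 dg))).
by rewrite /GRing.scale/=; field.
Qed.

Lemma is_derive_expRf : is_derive t 1 (fun s => expR (f s)) (expR (f t) * a).
Proof. exact: (is_derive1_comp (is_derive_expR (f t)) df). Qed.

Lemma is_derive_cosf : is_derive t 1 (fun s => cos (f s)) (- sin (f t) * a).
Proof. exact: (is_derive1_comp (is_derive_cos (f t)) df). Qed.

Lemma is_derive_sinf : is_derive t 1 (fun s => sin (f s)) (cos (f t) * a).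
Proof. exact: (is_derive1_comp (is_derive_sin (f t)) df). Qed.

Lemma is_derive_atanf :
  is_derive t 1 (fun s => atan (f s)) (a / (1 + f t ^+ 2)).
Proof.
apply: (is_derive_eq (is_derive1_comp (is_derive1_atan (f t)) df)).
exact: mulrC.
Qed.

Lemma is_derive_lnf : 0 < f t -> is_derive t 1 (fun s => ln (f s)) (a / f t).
Proof.
move=> f0; apply: (is_derive_eq (is_derive1_comp (is_derive1_ln f0) df)).
exact: mulrC.
Qed.

Lemma is_derive_sqrtf : 0 < f t ->
  is_derive t 1 (fun s => Num.sqrt (f s)) (a / (2 * Num.sqrt (f t))).
Proof.
move=> f0; apply: (is_derive_eq (is_derive1_comp (is_derive1_sqrt f0) df)).
exact: mulrC.
Qed.

End real_derivation_rules.

(** * The function exp (- M z^rho) in real coordinates *)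

Section holomorphic_kernel.
Context {R : realType}.
Variables rho M : R.
Implicit Types x y a b : R.

Definition modulus x y : R := Num.sqrt (x ^+ 2 + y ^+ 2).

(* The half-angle formula gives the argument on the whole plane slit along the
   negative real axis. *)
Definition argument x y : R := 2 * atan (y / (modulus x y + x)).

Definition modulus_pow x y : R := expR (rho * ln (modulus x y)).

Definition re_pow x y := modulus_pow x y * cos (rho * argument x y).
Definition im_pow x y := modulus_pow x y * sin (rho * argument x y).

Definition re_exp x y := expR (- M * re_pow x y) * cos (M * im_pow x y).
Definition im_exp x y := - (expR (- M * re_pow x y) * sin (M * im_pow x y)).

(* The real part of the derivative of exp (- M z^rho), with 1/z written as conj z / |z|^2. *)
Definition re_exp_deriv x y :=
  - (M * rho) / modulus x y ^+ 2 *
  (x * (re_pow x y * re_exp x y - im_pow x y * im_exp x y) +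
   y * (re_pow x y * im_exp x y + im_pow x y * re_exp x y)).

Lemma modulus_ge0 x y : 0 <= modulus x y. Proof. exact: sqrtr_ge0. Qed.

Lemma modulus_sqr x y : modulus x y ^+ 2 = x ^+ 2 + y ^+ 2.
Proof. by rewrite sqr_sqrtr// addr_ge0// sqr_ge0. Qed.

(** The hypothesis says that (x, y) lies off the slit y = 0, x <= 0; the slit plane enters all later
    lemmas in this form. *)
Lemma modulus_gt0 x y : 0 < modulus x y + x -> 0 < modulus x y.
Proof.
move=> mx; rewrite lt_neqAle modulus_ge0 andbT; apply/eqP => m0.
have := modulus_sqr x y; nra.
Qed.

Section along_a_curve.
Variables (X Y : R -> R) (t a b : R).
Hypotheses (dX : is_derive t 1 X a) (dY : is_derive t 1 Y b).
Hypothesis slit : 0 < modulus (X t) (Y t) + X t.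

Local Notation r := (modulus (X t) (Y t)).

Lemma is_derive_modulus :
  is_derive t 1 (fun s => modulus (X s) (Y s)) ((X t * a + Y t * b) / r).
Proof.
have r0 := modulus_gt0 slit.
have s0 : 0 < X t ^+ 2 + Y t ^+ 2 by rewrite -modulus_sqr exprn_gt0.
have dS : is_derive t 1 (fun s => X s ^+ 2 + Y s ^+ 2) (2 * (X t * a + Y t * b)).
  apply: (is_derive_eq (is_derive_addf (is_derive_mulf dX dX) (is_derive_mulf dY dY))).
  by ring.
apply: (is_derive_eq (is_derive_sqrtf dS s0)).
by rewrite -/(modulus _ _); field; rewrite gt_eqF.
Qed.

Lemma is_derive_argument :
  is_derive t 1 (fun s => argument (X s) (Y s)) ((X t * b - Y t * a) / r ^+ 2).
Proof.
have r0 := modulus_gt0 slit; have dr := is_derive_modulus.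
have dQ := is_derive_divf dY (is_derive_addf dr dX) (lt0r_neq0 slit).
apply: (is_derive_eq (is_derive_scalef (is_derive_atanf dQ) 2)).
have := modulus_sqr (X t) (Y t); move: r0 slit.
move: (X t) (Y t) (modulus _ _) => x y r r0 rx r2.
have y2 : y ^+ 2 = r ^+ 2 - x ^+ 2 by rewrite r2 addrC addKr.
(* Here y / (r + x) is the tangent of the half-angle, and y^2 = (r - x) (r + x). *)
have -> : 1 + (y / (r + x)) ^+ 2 = 2 * r / (r + x).
  by rewrite expr_div_n y2; field; rewrite gt_eqF.
have -> : y * ((x * a + y * b) / r + a) = (y * x * a + y ^+ 2 * b) / r + y * a.
  by field; rewrite gt_eqF.
by rewrite y2; field; rewrite !gt_eqF.
Qed.

Local Notation P := (re_pow (X t) (Y t)).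
Local Notation Q := (im_pow (X t) (Y t)).

Let dlogr : is_derive t 1 (fun s => rho * ln (modulus (X s) (Y s)))
  (rho * ((X t * a + Y t * b) / r ^+ 2)).
Proof.
have r0 := modulus_gt0 slit.
apply: (is_derive_eq (is_derive_scalef (is_derive_lnf is_derive_modulus r0) rho)).
by field; rewrite gt_eqF.
Qed.

Let darg := is_derive_scalef is_derive_argument rho.

(** With c = a + i b, this and the next lemma are the two parts of (z^rho)' c = rho z^rho (conj z c)
    / |z|^2, where conj z c has real part X a + Y b and imaginary part X b - Y a. *)
Lemma is_derive_re_pow : is_derive t 1 (fun s => re_pow (X s) (Y s))
  (rho / r ^+ 2 * (P * (X t * a + Y t * b) - Q * (X t * b - Y t * a))).
Proof.
apply: (is_derive_eq (is_derive_mulf (is_derive_expRf dlogr) (is_derive_cosf darg))).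
by rewrite /re_pow /im_pow /modulus_pow; ring.
Qed.

Lemma is_derive_im_pow : is_derive t 1 (fun s => im_pow (X s) (Y s))
  (rho / r ^+ 2 * (Q * (X t * a + Y t * b) + P * (X t * b - Y t * a))).
Proof.
apply: (is_derive_eq (is_derive_mulf (is_derive_expRf dlogr) (is_derive_sinf darg))).
by rewrite /re_pow /im_pow /modulus_pow; ring.
Qed.

Let ddecay := is_derive_expRf (is_derive_scalef is_derive_re_pow (- M)).
Let dphase := is_derive_scalef is_derive_im_pow M.

(* With c = a + i b, the left side is the derivative of Re (conj c * exp (- M z^rho)),
   whose value Re (conj c * c * (exp (- M z^rho))') depends on c only through |c|. *)
Lemma is_derive_re_conj_exp :
  is_derive t 1 (fun s => a * re_exp (X s) (Y s) + b * im_exp (X s) (Y s))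
    ((a ^+ 2 + b ^+ 2) * re_exp_deriv (X t) (Y t)).
Proof.
have dre := is_derive_mulf ddecay (is_derive_cosf dphase).
have dim := is_derive_oppf (is_derive_mulf ddecay (is_derive_sinf dphase)).
apply: (is_derive_eq (is_derive_addf (is_derive_scalef dre a) (is_derive_scalef dim b))).
rewrite /re_exp_deriv /re_exp /im_exp; ring.
Qed.

End along_a_curve.

(** A general filter serves both for continuity along a line and for continuity on the plane. *)
Lemma cvg_re_exp_deriv (T : Type) (F : set_system T) (FF : Filter F)
    (X Y : T -> R) x y : 0 < modulus x y + x ->
    X s @[s --> F] --> x -> Y s @[s --> F] --> y ->
  re_exp_deriv (X s) (Y s) @[s --> F] --> re_exp_deriv x y.
Proof.
move=> slit Xx Yy; have r0 := modulus_gt0 slit.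
have cr : modulus (X s) (Y s) @[s --> F] --> modulus x y.
  apply: continuous_cvg; first exact: sqrt_continuous.
  by apply: cvgD; apply: cvgM.
have ca : argument (X s) (Y s) @[s --> F] --> argument x y.
  apply: cvgMr; apply: continuous_cvg; first exact: continuous_atan.
  apply: cvgM => //; apply: cvgV; first exact: lt0r_neq0.
  exact: cvgD.
have cp : modulus_pow (X s) (Y s) @[s --> F] --> modulus_pow x y.
  apply: continuous_cvg; first exact: continuous_expR.
  apply: cvgMr; apply: continuous_cvg => //; exact: continuous_ln.
have cP : re_pow (X s) (Y s) @[s --> F] --> re_pow x y.
  apply: cvgM => //; apply: continuous_cvg; first exact: continuous_cos.
  exact: cvgMr.
have cQ : im_pow (X s) (Y s) @[s --> F] --> im_pow x y.
  apply: cvgM => //; apply: continuous_cvg; first exact: continuous_sin.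
  exact: cvgMr.
have cE : expR (- M * re_pow (X s) (Y s)) @[s --> F] --> expR (- M * re_pow x y).
  by apply: continuous_cvg; [exact: continuous_expR|exact: cvgMr].
have cA : re_exp (X s) (Y s) @[s --> F] --> re_exp x y.
  apply: cvgM => //; apply: continuous_cvg; first exact: continuous_cos.
  exact: cvgMr.
have cB : im_exp (X s) (Y s) @[s --> F] --> im_exp x y.
  apply: cvgN; apply: cvgM => //; apply: continuous_cvg.
    exact: continuous_sin.
  exact: cvgMr.
apply: cvgM.
  apply: cvgMr; apply: cvgV; first by rewrite expf_neq0 ?gt_eqF.
  exact: cvgM.
apply: cvgD; apply: cvgM => //.
  by apply: cvgB; exact: cvgM.
by apply: cvgD; exact: cvgM.
Qed.

End holomorphic_kernel.

(** * Argument, modulus and decay on a sector *)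

Section sector_estimates.
Context {R : realType}.
Implicit Types x y k th : R.

(** The sector misses the slit: where x <= 0 it forces y != 0, hence |x| < |z|. *)
Lemma modulus_sector_gt0 k x y : 0 <= k -> 0 < x + k * `|y| -> 0 < modulus x y + x.
Proof.
move=> k0 xy; have r0 := modulus_ge0 x y; have r2 := modulus_sqr x y.
have [x0|x0] := ltP 0 x; first by rewrite ltr_wpDl.
have y0 : 0 < `|y|.
  rewrite lt_neqAle normr_ge0 andbT; apply/eqP => y0.
  by move: xy; rewrite -y0 mulr0 addr0 ltNge x0.
rewrite ltNge; apply/negP => rx; move: r2; rewrite -(real_normK (num_real y)); nra.
Qed.

Lemma normr_le_modulus x y : `|x| <= modulus x y.
Proof. by rewrite -sqrtr_sqr ler_sqrt ?lerDl ?sqr_ge0// addr_ge0 ?sqr_ge0. Qed.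

Lemma normr_le_modulusr x y : `|y| <= modulus x y.
Proof. by rewrite -sqrtr_sqr ler_sqrt ?lerDr ?sqr_ge0// addr_ge0 ?sqr_ge0. Qed.

(** Both x and |y| are at most |z|, so 1 < (1 + k) |z|. This keeps z away from the singularity of 1
    / z. *)
Lemma modulus_sector_ge k x y : 0 <= k -> 1 < x + k * `|y| ->
  (1 + k)^-1 <= modulus x y.
Proof.
move=> k0 xy.
have := normr_le_modulus x y; have := normr_le_modulusr x y; have := ler_norm x.
rewrite -div1r ler_pdivrMr; last by rewrite ltr_pwDl.
nra.
Qed.

(** This is - cot (2 th), so that x + k |y| >= 0 describes the sector |arg z| <= 2 th. *)
Definition sector_slope th : R := (tan th ^+ 2 - 1) / (2 * tan th).

Lemma normr_argument_sector th x y : 0 < th < pi / 2 -> 1 <= tan th ->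
  0 < modulus x y + x -> 0 <= x + sector_slope th * `|y| ->
  `|argument x y| <= 2 * th.
Proof.
move=> /andP[th0 thp] T1 slit sec.
have r0 := modulus_ge0 x y; have r2 := modulus_sqr x y.
have T0 : 0 < tan th := lt_le_trans ltr01 T1.
rewrite normrM ger0_norm// ler_pM2l//.
rewrite -[leRHS]tanK ?in_itv/= ?thp ?andbT; last first.
  by rewrite (lt_trans _ th0)// oppr_lt0 divr_gt0 ?pi_gt0.
(* Since |y| / (r + x) is the tangent of |arg z| / 2, this inequality is the claim before taking
   [atan]. *)
have yT : `|y| <= tan th * (modulus x y + x).
  have : 0 <= 2 * tan th * x + (tan th ^+ 2 - 1) * `|y|.
    have -> : 2 * tan th * x + (tan th ^+ 2 - 1) * `|y| =
      2 * tan th * (x + sector_slope th * `|y|).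
      by rewrite /sector_slope; field; rewrite gt_eqF.
    by rewrite mulr_ge0// mulr_ge0// ltW.
  move: r2; rewrite -(real_normK (num_real y)).
  move: (normr_ge0 y) T0 T1 r0 slit; move: (modulus x y) (tan th) `|y| => r T z.
  move=> z0 T0 T1 r0 slit r2 sec'.
  (* If z > T x, both sides of z - T x <= T r can be squared, and (T r)^2 - (z - T x)^2 = z (2 T x +
     (T^2 - 1) z) is nonnegative by the sector condition. *)
  have [zx|zx] := leP z (T * x); first by nra.
  rewrite -subr_ge0 leNgt; apply/negP => neg.
  have h1 : T * r < z - T * x by lra.
  have h2 : (T * r) ^+ 2 < (z - T * x) ^+ 2.
    by rewrite ltr_pXn2r// nnegrE; nra.
  have h3 : 0 <= z * (2 * T * x + (T ^+ 2 - 1) * z) by rewrite mulr_ge0.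
  have : (T * r) ^+ 2 = T ^+ 2 * (x ^+ 2 + z ^+ 2) by rewrite -r2; ring.
  nra.
have /ler_normlP[wl wr] : `|y / (modulus x y + x)| <= tan th.
  by rewrite normf_div (gtr0_norm slit) ler_pdivrMr.
rewrite ler_norml lerNl -atanN.
by rewrite !le_atan.
Qed.

Section decay.
Variables (rho th M : R).
Hypotheses (rho0 : 0 < rho) (th0 : 0 < th < pi / 2) (T1 : 1 <= tan th).
Hypotheses (rth : rho * (2 * th) < pi / 2) (M0 : 0 < M).

Local Notation k := (sector_slope th).

Let k0 : 0 <= k.
Proof.
have T0 : 0 < tan th := lt_le_trans ltr01 T1.
by apply: divr_ge0; [rewrite subr_ge0 exprn_ege1|rewrite mulr_ge0// ltW].
Qed.

(** The value of cos (rho arg z) on the boundary rays |arg z| = 2 th; Re z^rho is at least this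
    multiple of |z|^rho inside the sector. *)
Definition decay_rate : R := cos (rho * (2 * th)).

Lemma decay_rate_gt0 : 0 < decay_rate.
Proof.
case/andP: th0 => th0' _; apply: cos_gt0_pihalf; rewrite rth andbT.
by rewrite (@lt_le_trans _ _ 0)// ?mulr_ge0// ?ltW// oppr_lt0 divr_gt0 ?pi_gt0.
Qed.

(** The cosine is even and decreasing on [0, pi], and rho |arg z| <= rho (2 th) < pi / 2. *)
Lemma decay_rate_le x y : 1 < x + k * `|y| ->
  decay_rate <= cos (rho * argument x y).
Proof.
move=> sec; have th0' : 0 <= th by case/andP: th0 => /ltW.
have s0 : 0 < x + k * `|y| by exact: lt_trans sec.
have slit := modulus_sector_gt0 k0 s0.
have := normr_argument_sector th0 T1 slit (ltW s0) => arg.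
rewrite -[in leRHS]cos_norm normrM (gtr0_norm rho0) leNgt.
have le : rho * `|argument x y| <= rho * (2 * th) by rewrite ler_pM2l.
have lepi : rho * (2 * th) <= pi.
  by rewrite (le_trans (ltW rth))// ler_pdivrMr// ler_peMr ?pi_ge0// ler1n.
have ge0 z : 0 <= z -> 0 <= rho * z by move=> z0; rewrite mulr_ge0// ltW.
by rewrite ltr_cos -?leNgt ?in_itv/= ?lepi ?(le_trans le lepi) ?andbT// ge0// mulr_ge0.
Qed.

Lemma expR_re_pow_le x y : 1 < x + k * `|y| ->
  expR (- M * re_pow rho x y) <= expR (- (M * decay_rate) * modulus_pow rho x y).
Proof.
move=> sec; rewrite ler_expR /re_pow !mulNr lerN2 -!mulrA ler_pM2l//.
by rewrite mulrC ler_pM2l ?expR_gt0// decay_rate_le.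
Qed.

Lemma normr_re_exp_le x y : 1 < x + k * `|y| ->
  `|re_exp rho M x y| <= expR (- (M * decay_rate) * modulus_pow rho x y).
Proof.
move=> /expR_re_pow_le; apply: le_trans.
rewrite normrM ger0_norm ?expR_ge0// -[leRHS]mulr1.
by rewrite ler_pM2l ?expR_gt0// cos_max.
Qed.

Lemma normr_im_exp_le x y : 1 < x + k * `|y| ->
  `|im_exp rho M x y| <= expR (- (M * decay_rate) * modulus_pow rho x y).
Proof.
move=> /expR_re_pow_le; apply: le_trans.
rewrite normrN normrM ger0_norm ?expR_ge0// -[leRHS]mulr1.
by rewrite ler_pM2l ?expR_gt0// sin_max.
Qed.

(** The derivative carries the extra factors 1 / |z|, bounded by 1 + k, and |z|^rho, absorbed by exp
    (|z|^rho); the latter costs 1 in the rate. *)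
Lemma normr_re_exp_deriv_le x y : 1 < x + k * `|y| ->
  `|re_exp_deriv rho M x y| <= 4 * M * rho * (1 + k) *
    expR (- (M * decay_rate - 1) * modulus_pow rho x y).
Proof.
move=> sec.
have nA := normr_re_exp_le sec; have nB := normr_im_exp_le sec.
have rk := modulus_sector_ge k0 sec.
have nx := normr_le_modulus x y; have ny := normr_le_modulusr x y.
have m1 : modulus_pow rho x y <= expR (modulus_pow rho x y).
  by have := expR_ge1Dx (modulus_pow rho x y); lra.
have -> : - (M * decay_rate - 1) * modulus_pow rho x y =
  - (M * decay_rate) * modulus_pow rho x y + modulus_pow rho x y by ring.
rewrite expRD.
have nP : `|re_pow rho x y| <= modulus_pow rho x y.
  rewrite normrM ger0_norm ?expR_ge0// -[leRHS]mulr1.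
  by rewrite ler_pM2l ?expR_gt0// cos_max.
have nQ : `|im_pow rho x y| <= modulus_pow rho x y.
  rewrite normrM ger0_norm ?expR_ge0// -[leRHS]mulr1.
  by rewrite ler_pM2l ?expR_gt0// sin_max.
have mp : 0 < modulus_pow rho x y := expR_gt0 _.
have kp : 0 < (1 + k)^-1 by rewrite invr_gt0 ltr_pwDl.
move: mp m1 nA nB nP nQ nx ny rk; rewrite /re_exp_deriv.
set S := expR (- _ * _).
move: (re_pow _ _ _) (im_pow _ _ _) (re_exp _ _ _ _) (im_exp _ _ _ _).
move: (modulus_pow _ _ _) (modulus _ _) => m r P Q A B.
move=> mp m1 nA nB nP nQ nx ny rk.
have rp : 0 < r := lt_le_trans kp rk.
have prodle (u v a b : R) : `|u| <= a -> `|v| <= b -> `|u * v| <= a * b.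
  by move=> ua vb; rewrite normrM ler_pM.
have sumle (u v a b : R) : `|u| <= a -> `|v| <= b -> `|u + v| <= a + b.
  by move=> ua vb; apply: le_trans (ler_normD _ _) _; exact: lerD.
(* Expanding gives four products, each at most r m S. *)
have nsum : `|x * (P * A - Q * B) + y * (P * B + Q * A)| <= 4 * r * m * S.
  have -> : 4 * r * m * S = r * (m * S + m * S) + r * (m * S + m * S) by ring.
  by apply: (sumle); apply: (prodle) => //; apply: (sumle); rewrite ?normrN; apply: (prodle).
rewrite normrM; apply: le_trans (ler_wpM2l (normr_ge0 _) nsum) _.
rewrite mulNr normrN ger0_norm; last by rewrite divr_ge0// ltW// ?mulr_gt0// exprn_gt0.
have -> : M * rho / r ^+ 2 * (4 * r * m * S) = 4 * M * rho * r^-1 * (S * m).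
  by field; rewrite gt_eqF.
apply: ler_pM.
- by rewrite mulr_ge0 ?invr_ge0 ?(ltW rp)// !mulr_ge0// ltW.
- by rewrite mulr_ge0 ?expR_ge0// ltW.
- rewrite ler_pM2l; last by rewrite !mulr_gt0.
  by rewrite invf_ple// posrE ltr_pwDl.
- by rewrite ler_pM2l ?expR_gt0.
Qed.

(** The maximum over r > 0 of r^2 exp (- r^rho), attained where r^rho = 2 / rho. *)
Definition pow_decay_const : R := expR (- (2 / rho * (1 - ln (2 / rho)))).

(* With r = exp L and q = 2 / rho, [exp (rho L - ln q) >= 1 + rho L - ln q] bounds r^rho
   below by 2 L + q (1 - ln q). *)
Lemma expR_modulus_pow_le x y : 0 < modulus x y ->
  expR (- modulus_pow rho x y) <= pow_decay_const / modulus x y ^+ 2.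
Proof.
move=> r0; have q0 : 0 < 2 / rho by rewrite divr_gt0.
have -> : modulus x y ^+ 2 = expR (2 * ln (modulus x y)).
  by rewrite expRM_natl lnK.
rewrite -expRN -expRD ler_expR -opprD lerN2.
have m_ge : 1 + (rho * ln (modulus x y) - ln (2 / rho)) <= modulus_pow rho x y / (2 / rho).
  by rewrite /modulus_pow -[X in _ <= _ / X]lnK// -expRB; exact: expR_ge1Dx.
have -> : 2 / rho * (1 - ln (2 / rho)) + 2 * ln (modulus x y) =
  (1 + (rho * ln (modulus x y) - ln (2 / rho))) * (2 / rho).
  by field; rewrite gt_eqF.
by rewrite -ler_pdivlMr.
Qed.

(** * Integrals along lines inside the sector *)

Section line_integral.
Variables (x0 y0 a b : R).
Hypotheses (ab0 : 0 < a ^+ 2 + b ^+ 2) (M_ge : 2 <= M * decay_rate).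
Hypothesis sector : forall t, 1 < (x0 + t * a) + k * `|y0 + t * b|.

Local Notation X t := (x0 + t * a).
Local Notation Y t := (y0 + t * b).

Let slit t : 0 < modulus (X t) (Y t) + X t.
Proof. by apply: (modulus_sector_gt0 k0); exact: lt_trans (sector t). Qed.

Let line_const : R := (1 + 2 * (x0 ^+ 2 + y0 ^+ 2) / (a ^+ 2 + b ^+ 2)) * (1 + k) ^+ 2 +
  2 / (a ^+ 2 + b ^+ 2).

(** With z = z0 + t c one has t^2 |c|^2 <= 2 (|z|^2 + |z0|^2). The constant terms 1 and 2 |z0|^2 /
    |c|^2 are turned into multiples of |z|^2 by 1 <= (1 + k)^2 |z|^2. *)
Let oneDsqr_le t : oneDsqr t <= line_const * modulus (X t) (Y t) ^+ 2.
Proof.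
have r0 := modulus_gt0 (slit t).
have rk : 1 <= (1 + k) ^+ 2 * modulus (X t) (Y t) ^+ 2.
  rewrite -exprMn exprn_ege1// mulrC -ler_pdivrMr ?div1r ?ltr_pwDl//.
  exact: modulus_sector_ge.
have tn : t ^+ 2 <= 2 * (modulus (X t) (Y t) ^+ 2 + (x0 ^+ 2 + y0 ^+ 2)) /
    (a ^+ 2 + b ^+ 2).
  rewrite ler_pdivlMr// modulus_sqr -subr_ge0.
  have -> : 2 * (X t ^+ 2 + Y t ^+ 2 + (x0 ^+ 2 + y0 ^+ 2)) - t ^+ 2 * (a ^+ 2 + b ^+ 2) =
    (X t + x0) ^+ 2 + (Y t + y0) ^+ 2 by ring.
  by rewrite addr_ge0 ?sqr_ge0.
have m0 : 0 <= 2 * (x0 ^+ 2 + y0 ^+ 2) / (a ^+ 2 + b ^+ 2).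
  by rewrite divr_ge0 ?mulr_ge0 ?addr_ge0 ?sqr_ge0.
have := lerD (lerD rk tn) (ler_wpM2l m0 rk).
rewrite -(lerD2r (- (2 * (x0 ^+ 2 + y0 ^+ 2) / (a ^+ 2 + b ^+ 2)))).
apply: etrans; congr (_ <= _); first by rewrite /oneDsqr; ring.
by rewrite /line_const; field; rewrite gt_eqF.
Qed.

Let line_decay t :
  expR (- modulus_pow rho (X t) (Y t)) <= pow_decay_const * line_const / oneDsqr t.
Proof.
have r0 := modulus_gt0 (slit t).
apply: le_trans (expR_modulus_pow_le r0) _.
rewrite -mulrA ler_pM2l ?expR_gt0//.
rewrite ler_pdivlMr ?(lt_le_trans ltr01 (oneDsqr_ge1 t))//.
by rewrite mulrC ler_pdivrMr ?exprn_gt0// oneDsqr_le.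
Qed.

Let expR_rate_le (e z : R) : 1 <= e -> 0 <= z -> expR (- e * z) <= expR (- z).
Proof. by move=> e1 z0; rewrite ler_expR mulNr lerN2 ler_peMl. Qed.

(** The primitive is Re (conj c exp (- M z^rho)) / |c|^2 with c = a + i b. By [M_ge] the rates of
    integrand and primitive are both at least 1, so that both are dominated by exp (- |z|^rho),
    hence by a multiple of 1 / (1 + t^2). *)
Lemma integral_re_exp_deriv_line :
  (\int[lebesgue_measure]_t (re_exp_deriv rho M (X t) (Y t))%:E = 0)%E.
Proof.
have M_ge1 : 1 <= M * decay_rate - 1 by rewrite lerBrDr.
have M_ge2 : 1 <= M * decay_rate by apply: le_trans M_ge; rewrite ler1n.
have dX (t : R) : is_derive t 1 (fun s : R => X s) a.
  have := is_derive_addf (is_derive_cst x0 t 1)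
    (is_derive_mulf (is_derive_id t 1) (is_derive_cst a t 1)).
  by move/is_derive_eq; apply; rewrite /cst/= mulr0 add0r mulr1 add0r.
have dY (t : R) : is_derive t 1 (fun s : R => Y s) b.
  have := is_derive_addf (is_derive_cst y0 t 1)
    (is_derive_mulf (is_derive_id t 1) (is_derive_cst b t 1)).
  by move/is_derive_eq; apply; rewrite /cst/= mulr0 add0r mulr1 add0r.
have cX : continuous (fun s : R => X s).
  by apply: derivable_continuous => t; exact: ex_derive.
have cY : continuous (fun s : R => Y s).
  by apply: derivable_continuous => t; exact: ex_derive.
pose n := a ^+ 2 + b ^+ 2.
pose C1 := 4 * M * rho * (1 + k).
pose C2 := n^-1 * (`|a| + `|b|).
have C10 : 0 <= C1 by rewrite !mulr_ge0 ?addr_ge0// ltW.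
have C20 : 0 <= C2 by apply: mulr_ge0; [rewrite invr_ge0 ltW|exact: addr_ge0].
have mp t : 0 <= modulus_pow rho (X t) (Y t) by exact: expR_ge0.
apply: (@integral_derive_eq0 _ (fun t => re_exp_deriv rho M (X t) (Y t))
  (fun t => n^-1 * (a * re_exp rho M (X t) (Y t) + b * im_exp rho M (X t) (Y t)))
  ((C1 + C2) * (pow_decay_const * line_const))).
- by move=> t; apply: cvg_re_exp_deriv => //; [exact: cX|exact: cY].
- move=> t; have := is_derive_scalef (is_derive_re_conj_exp rho M (dX t) (dY t) (slit t)) n^-1.
  by move/is_derive_eq; apply; rewrite mulrA mulVf ?mul1r// gt_eqF.
- move=> t; apply: le_trans (normr_re_exp_deriv_le (sector t)) _.
  rewrite -/C1 -mulrA; apply: ler_pM; rewrite ?expR_ge0 ?lerDl//.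
  by apply: le_trans (line_decay t); apply: expR_rate_le; [exact: M_ge1|exact: mp].
- move=> t; have nA := normr_re_exp_le (sector t).
  have nB := normr_im_exp_le (sector t).
  have E : expR (- (M * decay_rate) * modulus_pow rho (X t) (Y t)) <=
      pow_decay_const * line_const / oneDsqr t.
    by apply: le_trans (line_decay t); apply: expR_rate_le; [exact: M_ge2|exact: mp].
  rewrite -mulrA.
  apply: (@le_trans _ _ (C2 * (pow_decay_const * line_const / oneDsqr t))).
    rewrite normrM ger0_norm ?invr_ge0 ?(ltW ab0)// /C2 -mulrA.
    rewrite ler_pM2l ?invr_gt0// mulrDl.
    apply: le_trans (ler_normD _ _) _; rewrite (normrM a) (normrM b).
    apply: lerD; apply: ler_wpM2l => //.
      exact: le_trans nA E.
    exact: le_trans nB E.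
  apply: ler_wpM2r; last by rewrite lerDr.
  by apply: le_trans (line_decay t); exact: expR_ge0.
Qed.

End line_integral.
End decay.
End sector_estimates.

(** * Scalar products, cones and lines in the plane *)

Section plane_geometry.
Context {R : realType}.
Implicit Types (K : set (R * R)) (p u v w z n : R * R).

Lemma dotDr n z w : dot n (z + w) = dot n z + dot n w.
Proof. by rewrite /dot /=; ring. Qed.

Lemma dotZr n (t : R) z : dot n (t *: z) = t * dot n z.
Proof. by rewrite /dot /= /GRing.scale /=; ring. Qed.

Lemma dot_ge0 z : 0 <= dot z z.
Proof. by rewrite /dot addr_ge0// -expr2 sqr_ge0. Qed.

Lemma dot_gt0 z : z != 0 -> 0 < dot z z.
Proof.
move=> z0; rewrite lt_neqAle dot_ge0 andbT eq_sym; apply: contra z0.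
rewrite /dot paddr_eq0 -?expr2 ?sqr_ge0// !sqrf_eq0 => /andP[/eqP z1 /eqP z2].
by apply/eqP; case: z z1 z2 => ? ? /= -> ->.
Qed.

Lemma enorm_sqr z : enorm z ^+ 2 = dot z z.
Proof. by rewrite sqr_sqrtr// dot_ge0. Qed.

Lemma enorm1_neq0 z : enorm z = 1 -> z != 0.
Proof.
move=> z1; apply/eqP => z0; move: z1; rewrite z0 /enorm /dot /= mul0r addr0 sqrtr0.
by move=> /esym/eqP; rewrite oner_eq0.
Qed.

Lemma enorm_le_l1 z : enorm z <= `|z.1| + `|z.2|.
Proof.
rewrite -[leRHS]ger0_norm ?addr_ge0// -sqrtr_sqr ler_sqrt ?sqr_ge0//.
rewrite sqrrD !real_normK ?num_real// /dot -!expr2 -addrA lerD2l lerDr.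
by rewrite mulrn_wge0// mulr_ge0.
Qed.

Lemma ray_upper_bound (a b c : R) : (forall t, 0 <= t -> a + t * b <= c) -> b <= 0.
Proof.
move=> ub; rewrite leNgt; apply/negP => b0.
(* For this t the left side is a + |c - a| + 1, which exceeds c. *)
have := ub ((`|c - a| + 1) / b) (divr_ge0 (addr_ge0 (normr_ge0 _) ler01) (ltW b0)).
rewrite divfK ?gt_eqF//; have := ler_norm (c - a); lra.
Qed.

Lemma convex_midpoint K z w : convex_set K -> K z -> K w ->
  K (2^-1 *: z + 2^-1 *: w).
Proof.
move=> Kconv Kz Kw.
have h0 : 0 <= 2^-1 :> R by rewrite invr_ge0.
have h1 : 2^-1 <= 1 :> R by rewrite invf_le1// ler1n.
have := Kconv z w (Itv01 h0 h1); rewrite !inE => /(_ Kz Kw).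
congr (K _); rewrite /conv /= /unstable.onem.
by apply: injective_projections; rewrite /= /GRing.scale /=; field.
Qed.

(** The point is the midpoint of p + 2 s u and p + 2 t v, which lie on the two half-lines. *)
Lemma convex_cone K p u v (s t : R) : convex_set K ->
  half_line p u `|` half_line p v `<=` K -> 0 <= s -> 0 <= t ->
  K (p + s *: u + t *: v).
Proof.
move=> Kconv sub s0 t0.
have Ku : K (p + (2 * s) *: u) by apply: sub; left; exists (2 * s) => //=; rewrite mulr_ge0.
have Kv : K (p + (2 * t) *: v) by apply: sub; right; exists (2 * t) => //=; rewrite mulr_ge0.
have := convex_midpoint Kconv Ku Kv; congr (K _).
by apply: injective_projections; rewrite /= /GRing.scale /=; field.
Qed.

Definition cross u v : R := u.1 * v.2 - u.2 * v.1.

Lemma cross_eq0_colinear u w : u != 0 -> cross u w = 0 ->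
  w = (dot u w / dot u u) *: u.
Proof.
move=> u0 uw0; have d0 := dot_gt0 u0.
apply: injective_projections; rewrite /= /GRing.scale /=; apply/eqP.
  rewrite mulrAC eq_sym -subr_eq0; apply/eqP.
  have -> : dot u w * u.1 / dot u u - w.1 = u.2 * cross u w / dot u u.
    by rewrite [in RHS]/cross; move: d0; rewrite /dot => d0; field; rewrite gt_eqF.
  by rewrite uw0 mulr0 mul0r.
rewrite mulrAC eq_sym -subr_eq0; apply/eqP.
have -> : dot u w * u.2 / dot u u - w.2 = - u.1 * cross u w / dot u u.
  by rewrite [in RHS]/cross; move: d0; rewrite /dot => d0; field; rewrite gt_eqF.
by rewrite uw0 mulr0 mul0r.
Qed.

Lemma lines_meet p u q w : cross u w != 0 -> exists t s : R, p + t *: u = q + s *: w.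
Proof.
(* Cramer's rule. *)
move=> uw0; exists (cross (q - p) w / cross u w), (cross (q - p) u / cross u w).
move: uw0; rewrite /cross => uw0.
by apply: injective_projections; rewrite /= /GRing.scale /=; field.
Qed.

Lemma half_plane_direction n p u (c : R) :
  half_line p u `<=` half_plane n c -> dot n u <= 0.
Proof.
move=> sub; apply: (@ray_upper_bound (dot n p) _ c) => t t0.
by rewrite -dotZr -dotDr; apply: sub; exists t.
Qed.

(** Here v = l u with l != 0. A positive l would make the half-lines equal, so l < 0 and together
    they cover the line. *)
Lemma full_line_sub K p u v : u != 0 -> cross u v = 0 -> v != 0 ->
  half_line p u <> half_line p v -> half_line p u `|` half_line p v `<=` K ->
  line p u `<=` K.
Proof.
move=> u0 uv0 v0 neq sub.
have vE := cross_eq0_colinear u0 uv0; set l := _ / _ in vE.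
have l0 : l != 0 by apply: contra v0 => /eqP l0; rewrite vE l0 scale0r.
have ln0 : l < 0.
  rewrite ltNge; apply/negP => lge; apply: neq.
  have lp : 0 < l by rewrite lt_neqAle eq_sym l0.
  rewrite vE; apply/seteqP; split=> _ [t /= t0 <-].
    exists (t / l); first by rewrite /= divr_ge0// ltW.
    by rewrite scalerA divfK.
  exists (t * l); first by rewrite /= mulr_ge0// ltW.
  by rewrite scalerA.
move=> _ [t _ <-]; apply: sub.
have [t0|t0] := leP 0 t; [by left; exists t|right; exists (t / l)].
  by rewrite /= nmulr_rge0// invr_le0 ltW.
by rewrite vE scalerA divfK.
Qed.

End plane_geometry.

(** * The Gaussian function for opposite half-lines *)

Section degenerate_case.
Context {R : realType}.
Implicit Types (K : set (R * R)) (p u v w z n : R * R).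

(** Square 1 + s <= 2 (1 + s / 2) <= 2 exp (s / 2). *)
Lemma oneD_sqr_le_expR (s : R) : 0 <= s -> (1 + s) ^+ 2 <= 4 * expR s.
Proof.
move=> s0; have -> : expR s = expR (s / 2) ^+ 2.
  by rewrite -expRM_natl; congr expR; field.
have -> : 4 * expR (s / 2) ^+ 2 = (2 * expR (s / 2)) ^+ 2 by ring.
have e := expR_ge1Dx (s / 2); have e0 := expR_gt0 (s / 2).
by rewrite ler_pXn2r// ?nnegrE; lra.
Qed.

(** This is - 1/2 times the derivative of exp (- |z|^2) in the direction u, so it has a decaying
    primitive along every line parallel to u. *)
Definition gaussian_dipole u z : R := dot u z * expR (- dot z z).

Lemma cvg_gaussian_dipole u z : gaussian_dipole u w @[w --> z] --> gaussian_dipole u z.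
Proof.
apply: cvgM.
  by apply: cvgD; apply: cvgMr; [exact: cvg_fst|exact: cvg_snd].
apply: continuous_cvg; first exact: continuous_expR.
by apply: cvgN; apply: cvgD; apply: cvgM; (exact: cvg_fst || exact: cvg_snd).
Qed.

Lemma normr_dot_le u z : `|dot u z| <= enorm u * enorm z.
Proof.
rewrite -(@ler_pXn2r _ 2)// ?nnegrE ?mulr_ge0 ?sqrtr_ge0//.
rewrite exprMn !enorm_sqr real_normK ?num_real// -subr_ge0.
have -> : dot u u * dot z z - dot u z ^+ 2 = cross u z ^+ 2.
  by rewrite /dot /cross; ring.
exact: sqr_ge0.
Qed.

Lemma gaussian_dipole_decay u (rho mu : R) : 0 <= rho <= 1 -> 0 < mu ->
  exists2 C : R, 0 < C & forall z,
    `|gaussian_dipole u z| <= C * expR (- mu * enorm z `^ rho).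
Proof.
move=> /andP[r0 r1] mu0.
(* The summand [mu] comes from |z|^rho <= 1 + |z|, and (1 + mu)^2 / 4 is the maximum of (1 + mu) s -
   s^2. Adding 1 to [enorm u] keeps the constant positive when u = 0. *)
exists ((enorm u + 1) * expR (mu + (1 + mu) ^+ 2 / 4)).
  by rewrite mulr_gt0 ?expR_gt0// ltr_wpDl// sqrtr_ge0.
move=> z; have s0 : 0 <= enorm z := sqrtr_ge0 _.
rewrite normrM [X in _ * X]ger0_norm ?expR_ge0// -enorm_sqr -mulrA -expRD.
apply: le_trans (ler_wpM2r (expR_ge0 _) (normr_dot_le u z)) _.
rewrite -mulrA; apply: ler_pM; rewrite ?mulr_ge0 ?sqrtr_ge0 ?expR_ge0 ?lerDl//.
have pow_le : enorm z `^ rho <= 1 + enorm z.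
  apply: le_trans (_ : (1 + enorm z) `^ rho <= _).
    by apply: ge0_ler_powR => //; rewrite ?nnegrE ?addr_ge0// lerDr.
  by apply: ler1_powR => //; rewrite lerDl.
have z_le : enorm z <= expR (enorm z) by have := expR_ge1Dx (enorm z); lra.
apply: le_trans (ler_wpM2r (expR_ge0 _) z_le) _.
rewrite -expRD ler_expR.
have := ler_wpM2l (ltW mu0) pow_le.
have := sqr_ge0 (enorm z - (1 + mu) / 2).
rewrite mulNr; move: (enorm z `^ rho) (enorm z) => e s; nra.
Qed.

Lemma integral_gaussian_dipole_line q w (c : R) : enorm w = 1 -> c != 0 ->
  line_integral (gaussian_dipole (c *: w)) q w = 0%E.
Proof.
move=> w1 c0; have ww : dot w w = 1 by rewrite -enorm_sqr w1 expr1n.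
pose S (t : R) := dot (q + t *: w) (q + t *: w).
have SE t : S t = dot q q + 2 * (t * dot q w) + t * t.
  have -> : t * t = t * t * dot w w by rewrite ww mulr1.
  by rewrite /S /dot /= /GRing.scale /=; ring.
have dS (t : R) : is_derive t 1 S (2 * (dot q w + t)).
  rewrite (_ : S = fun s : R => dot q q + 2 * (s * dot q w) + s * s); last first.
    by apply/funext.
  have did := is_derive_id t (1 : R).
  apply: (is_derive_eq (is_derive_addf (is_derive_addf (is_derive_cst (dot q q) t 1)
    (is_derive_scalef (is_derive_mulf did (is_derive_cst (dot q w) t 1)) 2))
    (is_derive_mulf did did))).
  by rewrite /cst/=; ring.
pose f (t : R) := c * ((dot q w + t) * expR (- S t)).
pose F (t : R) := - (c / 2) * expR (- S t).
have fE t : gaussian_dipole (c *: w) (q + t *: w) = f t.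
  rewrite /gaussian_dipole -/(S t) /f mulrA; congr (_ * _).
  have -> : dot q w + t = dot q w + t * dot w w by rewrite ww mulr1.
  by rewrite /dot /= /GRing.scale /=; ring.
rewrite /line_integral; under eq_integral do rewrite fE.
have S0 t : 0 <= S t by exact: dot_ge0.
have qw2 : dot q w ^+ 2 <= dot q q.
  have := normr_dot_le q w; rewrite w1 mulr1 => h.
  by rewrite -enorm_sqr -[leLHS]real_normK ?num_real// ler_pXn2r ?nnegrE ?sqrtr_ge0.
(* The constant comes from t^2 = |t w|^2 <= 2 |q + t w|^2 + 2 |q|^2. *)
pose L : R := 2 + 2 * dot q q.
have q0 : 0 <= dot q q := dot_ge0 q.
have t_le t : oneDsqr t <= L * (1 + S t).
  have : t ^+ 2 <= 2 * S t + 2 * dot q q.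
    by rewrite SE; have := sqr_ge0 (2 * dot q w + t); nra.
  have := mulr_ge0 q0 (S0 t); rewrite /oneDsqr /L; nra.
(* The bounds on b and on 1 + t^2 contribute one factor 1 + S each, and (1 + S)^2 exp (- S) <= 4. *)
have e_le t (b : R) : 0 <= b -> b <= 1 + S t ->
    b * expR (- S t) <= 4 * L / oneDsqr t.
  move=> b0 bS; rewrite ler_pdivlMr ?(lt_le_trans ltr01 (oneDsqr_ge1 t))//.
  rewrite expRN mulrAC ler_pdivrMr ?expR_gt0//.
  have h := oneD_sqr_le_expR (S0 t).
  apply: (@le_trans _ _ ((1 + S t) * (L * (1 + S t)))).
    by apply: ler_pM => //; exact: (le_trans ler01 (oneDsqr_ge1 t)).
  have L0 : 0 <= L by rewrite /L; lra.
  by have := ler_wpM2l L0 h; lra.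
apply: (@integral_derive_eq0 _ f F (`|c| * (4 * L))).
- have cS : continuous S by apply: derivable_continuous => t; exact: ex_derive.
  move=> t; apply: cvgMr; apply: cvgM.
    by apply: cvgD; [exact: cvg_cst|exact: cvg_id].
  by apply: continuous_cvg; [exact: continuous_expR|apply: cvgN; exact: cS].
- move=> t; apply: (is_derive_eq (is_derive_scalef
    (is_derive_expRf (is_derive_oppf (dS t))) (- (c / 2)))).
  by rewrite /f; field.
- move=> t; rewrite /f !normrM -!mulrA ler_wpM2l// (ger0_norm (expR_ge0 _)) mulrA.
  apply: e_le => //.
  have s2 : (dot q w + t) ^+ 2 <= S t by rewrite SE; nra.
  have := real_normK (num_real (dot q w + t)).
  by have := normr_ge0 (dot q w + t); nra.
- move=> t; rewrite /F normrM normrN normrM -!mulrA ler_wpM2l//.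
  rewrite ger0_norm// (ger0_norm (expR_ge0 _)) mulrA.
  by apply: e_le; have := S0 t; lra.
Qed.

End degenerate_case.

(** * Affine coordinates adapted to the cone of two independent half-lines *)

Section transverse_case.
Context {R : realType}.
Implicit Types (z w n : R * R).
Variables (p u v : R * R) (k : R).
Hypothesis uv0 : cross u v != 0.

(* The affine coordinates are chosen so that the cone p + {s u + t v | s, t >= 0}
   becomes {x <= 1 - k |y|}. *)
Definition cone_dx w : R := - k * ((cross w v + cross u w) / cross u v).
Definition cone_dy w : R := (cross w v - cross u w) / cross u v.
Definition cone_x z : R := 1 + cone_dx (z - p).
Definition cone_y z : R := cone_dy (z - p).

Lemma cone_x_line z w (t : R) : cone_x (z + t *: w) = cone_x z + t * cone_dx w.
Proof. by rewrite /cone_x /cone_dx /cross /= /GRing.scale /=; ring. Qed.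

Lemma cone_y_line z w (t : R) : cone_y (z + t *: w) = cone_y z + t * cone_dy w.
Proof. by rewrite /cone_y /cone_dy /cross /= /GRing.scale /=; ring. Qed.

Lemma cone_coordinates z :
  z = p + (cross (z - p) v / cross u v) *: u + (cross u (z - p) / cross u v) *: v.
Proof.
move: uv0; rewrite /cross => d0.
by apply: injective_projections; rewrite /= /GRing.scale /=; field.
Qed.

Lemma cone_xE z :
  cone_x z = 1 - k * (cross (z - p) v / cross u v + cross u (z - p) / cross u v).
Proof. by rewrite -mulrDl -mulNr. Qed.

Lemma cone_yE z :
  cone_y z = cross (z - p) v / cross u v - cross u (z - p) / cross u v.
Proof. by rewrite -mulrBl. Qed.

(** Write z = p + s u + t v. If x <= 1 - k |y|, then |s - t| <= s + t, so s and t are nonnegative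
    and z lies in the cone, hence in K. *)
Lemma cone_complement_sector (K : set (R * R)) z : 0 < k -> convex_set K ->
  half_line p u `|` half_line p v `<=` K -> ~ K z ->
  1 < cone_x z + k * `|cone_y z|.
Proof.
move=> k0 Kconv sub; have := cone_coordinates z; rewrite cone_xE cone_yE.
move: (_ / _) (_ / _) => t s zE Kz; rewrite ltNge; apply/negP => le1; apply: Kz.
have : k * `|s - t| <= k * (s + t) by lra.
rewrite ler_pM2l// => /ler_normlP[h1 h2].
by rewrite zE; apply: convex_cone => //; lra.
Qed.

(** The linear part of the coordinate change is injective, so lines go to lines and not to
    points. *)
Lemma cone_direction_gt0 w : 0 < k -> w != 0 -> 0 < cone_dx w ^+ 2 + cone_dy w ^+ 2.
Proof.
move=> k0 w0; rewrite lt_neqAle addr_ge0 ?sqr_ge0// andbT eq_sym.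
apply: contra w0; rewrite paddr_eq0 ?sqr_ge0// !sqrf_eq0 => /andP[].
rewrite mulf_eq0 oppr_eq0 gt_eqF//= /cone_dy !mulf_eq0 invr_eq0 (negPf uv0) !orbF.
move=> /eqP s0 /eqP d0; apply/eqP.
have wE : w = (cross w v / cross u v) *: u + (cross u w / cross u v) *: v.
  have e : p + w - p = w by rewrite addrC addKr.
  by have := cone_coordinates (p + w); rewrite e -addrA => /addrI.
have wv : cross w v = 0 by lra.
have uw : cross u w = 0 by lra.
by rewrite wE wv uw !mul0r !scale0r addr0.
Qed.

Definition cone_const : R :=
  (1 + k) * (`|p.1| + `|p.2|) +
  ((2 + k) / k + 1) * (`|u.1| + `|u.2| + (`|v.1| + `|v.2|)).

(** In z = p + s u + t v, the formulas x = 1 - k (s + t) and y = s - t bound |s + t| by (2 + k) / k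
    r and |s - t| by r, hence both |s| and |t|. The fixed vector p is absorbed by 1 <= (1 + k) r. *)
Lemma enorm_le_modulus z : 0 < k -> 1 < cone_x z + k * `|cone_y z| ->
  enorm z <= cone_const * modulus (cone_x z) (cone_y z).
Proof.
move=> k0 sec.
have r1 := modulus_sector_ge (ltW k0) sec.
set r := modulus _ _ in r1 *.
have {}r1 : 1 <= (1 + k) * r.
  by rewrite mulrC -ler_pdivrMr ?div1r// ltr_pwDl// ltW.
have nx : `|cone_x z| <= r := normr_le_modulus _ _.
have ny : `|cone_y z| <= r := normr_le_modulusr _ _.
apply: le_trans (enorm_le_l1 z) _.
pose s := cross (z - p) v / cross u v; pose t := cross u (z - p) / cross u v.
have zE : z = p + s *: u + t *: v by exact: cone_coordinates.
have xE : cone_x z = 1 - k * (s + t) := cone_xE z.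
have yE : cone_y z = s - t := cone_yE z.
have r0 : 0 <= r by exact: modulus_ge0.
have st : `|s + t| <= (2 + k) / k * r.
  rewrite mulrAC ler_pdivlMr// mulrC -[X in X * _]gtr0_norm// -normrM.
  have -> : k * (s + t) = 1 - cone_x z by rewrite xE; ring.
  apply: le_trans (ler_normB _ _) _; rewrite normr1; lra.
have c0 : 0 <= (2 + k) / k by rewrite divr_ge0 ?addr_ge0// ltW.
have sr : `|s| <= ((2 + k) / k + 1) * r.
  move: st ny; rewrite yE => st ny; rewrite mulrDl mul1r.
  have -> : s = 2^-1 * ((s + t) + (s - t)) by field.
  rewrite normrM ger0_norm ?invr_ge0// ler_pdivrMl//.
  apply: le_trans (ler_normD _ _) _.
  have := mulr_ge0 c0 r0; lra.
have tr : `|t| <= ((2 + k) / k + 1) * r.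
  move: st ny; rewrite yE => st ny; rewrite mulrDl mul1r.
  have -> : t = 2^-1 * ((s + t) - (s - t)) by field.
  rewrite normrM ger0_norm ?invr_ge0// ler_pdivrMl//.
  apply: le_trans (ler_normB _ _) _.
  have := mulr_ge0 c0 r0; lra.
have comb (a b c : R) : `|a + s * b + t * c| <=
    `|a| * ((1 + k) * r) + ((2 + k) / k + 1) * r * `|b| + ((2 + k) / k + 1) * r * `|c|.
  apply: le_trans (ler_normD _ _) _; apply: lerD; last by rewrite normrM ler_wpM2r.
  apply: le_trans (ler_normD _ _) _; apply: lerD; last by rewrite normrM ler_wpM2r.
  by rewrite ler_peMr.
have := lerD (comb p.1 u.1 v.1) (comb p.2 u.2 v.2).
have -> : p.1 + s * u.1 + t * v.1 = z.1 by rewrite [in RHS]zE.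
have -> : p.2 + s * u.2 + t * v.2 = z.2 by rewrite [in RHS]zE.
move=> h; apply: le_trans h _; rewrite le_eqVlt; apply/orP; left; apply/eqP.
by rewrite /cone_const; ring.
Qed.

Lemma cone_const_ge0 : 0 < k -> 0 <= cone_const.
Proof.
move=> k0; have k1 := ltW k0.
by rewrite /cone_const addr_ge0// mulr_ge0 ?addr_ge0// divr_ge0// addr_ge0.
Qed.

(** Provides a point outside K on the axis y = 0 of the sector. The product of n with u + v is
    negative: otherwise n would be orthogonal to the independent vectors u and v. *)
Lemma cone_opposite_ray n (c : R) : n != 0 -> dot n u <= 0 -> dot n v <= 0 ->
  exists2 l : R, 0 < l & c < dot n (p - l *: (u + v)).
Proof.
move=> n0 nu nv.
have nuv : dot n (u + v) < 0.
  rewrite lt_neqAle dotDr; apply/andP; split; last by lra.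
  apply/negP => /eqP nuv0.
  have u0 : dot n u = 0 by lra.
  have v0 : dot n v = 0 by lra.
  have e1 : n.1 * cross u v = 0.
    have -> : n.1 * cross u v = v.2 * dot n u - u.2 * dot n v.
      by rewrite /cross /dot; ring.
    by rewrite u0 v0 !mulr0 subrr.
  have e2 : n.2 * cross u v = 0.
    have -> : n.2 * cross u v = u.1 * dot n v - v.1 * dot n u.
      by rewrite /cross /dot; ring.
    by rewrite u0 v0 !mulr0 subrr.
  move/eqP: n0; apply; apply: injective_projections => /=.
    by move/eqP: e1; rewrite mulf_eq0 (negPf uv0) orbF => /eqP.
  by move/eqP: e2; rewrite mulf_eq0 (negPf uv0) orbF => /eqP.
exists ((`|c - dot n p| + 1) / - dot n (u + v)).
  by rewrite divr_gt0 ?oppr_gt0// ltr_wpDl.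
have -> : dot n (p - ((`|c - dot n p| + 1) / - dot n (u + v)) *: (u + v)) =
    dot n p + (`|c - dot n p| + 1).
  by rewrite -scaleNr dotDr dotZr; field; rewrite lt_eqF.
have := ler_norm (c - dot n p); lra.
Qed.

End transverse_case.

(** * Construction of the null function in the two cases *)

Definition exterior_null_function (R : realType) (K : set (R * R)) (mu eps : R) :=
  exists (f : R * R -> R) (C : R),
    [/\ {within ~` K, continuous f},
        exists2 x, (~` K) x & f x != 0,
        0 < C,
        forall x, (~` K) x -> `|f x| <= C * expR (- mu * (enorm x `^ (1 - eps))) &
        forall q w : R * R, enorm w = 1 -> line q w `<=` ~` K ->
          line_integral f q w = 0%E].

Lemma transverse_exterior_null (R : realType) (K : set (R * R)) (p u v n : R * R)
    (c mu eps : R) : cross u v != 0 -> convex_set K ->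
    half_line p u `|` half_line p v `<=` K -> n != 0 -> K `<=` half_plane n c ->
    0 < mu -> 0 < eps -> eps < 1 ->
  exterior_null_function K mu eps.
Proof.
move=> uv0 Kconv sub n0 Kn mu0 eps0 eps1.
pose rho := 1 - eps; have rho0 : 0 < rho by rewrite subr_gt0.
(* The sector has half-opening 2 th = (pi / 2) (1 + eps), more than pi / 2 and less than pi, while
   rho (2 th) = (pi / 2) (1 - eps^2) stays below pi / 2. *)
pose th : R := pi / 4 * (1 + eps).
have pi0 := pi_gt0 R.
have thlt : pi / 4 < th by rewrite /th ltr_pMr ?divr_gt0//; lra.
have thpi : 0 < th < pi / 2 by apply/andP; split; rewrite /th; nra.
have rth : rho * (2 * th) < pi / 2.
  have -> : rho * (2 * th) = pi / 2 - eps ^+ 2 * (pi / 2) by rewrite /rho /th; field.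
  by rewrite gtrBl mulr_gt0 ?exprn_gt0// divr_gt0.
have T1 : 1 < tan th.
  by case/andP: thpi => ? ?; rewrite -tan_piquarter ltr_tan// in_itv/=; lra.
have T0 : 0 < tan th := lt_trans ltr01 T1.
pose k := sector_slope th.
have k0 : 0 < k.
  by apply: divr_gt0; [rewrite subr_gt0 exprn_egt1|rewrite mulr_gt0].
have c0 := decay_rate_gt0 rho0 thpi rth.
pose D := cone_const p u v k; have D0 : 0 <= D by exact: cone_const_ge0.
have muD : 0 <= mu * D `^ rho by rewrite mulr_ge0 ?powR_ge0// ltW.
(* The summand 2 meets the demand of the line integral; it also covers the unit of rate lost in the
   bound on the derivative. The factor D^rho pays for |z| <= D r. *)
have [M M0 MD] : exists2 M : R, 0 < M & M * decay_rate rho th = mu * D `^ rho + 2.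
  exists ((mu * D `^ rho + 2) / decay_rate rho th); last by rewrite divfK// gt_eqF.
  by rewrite divr_gt0// ltr_wpDl.
have C0 : 0 < 4 * M * rho * (1 + k).
  by apply: mulr_gt0; [rewrite !mulr_gt0|exact: addr_gt0].
pose f z := re_exp_deriv rho M (cone_x p u v k z) (cone_y p u v z).
have sec z : ~ K z -> 1 < cone_x p u v k z + k * `|cone_y p u v z|.
  exact: cone_complement_sector.
have slit z : ~ K z -> 0 < modulus (cone_x p u v k z) (cone_y p u v z) + cone_x p u v k z.
  by move=> /sec s1; apply: (modulus_sector_gt0 (ltW k0)); exact: lt_trans s1.
exists f, (4 * M * rho * (1 + k)); split.
- apply: continuous_in_subspaceT => z; rewrite inE => Kz.
  have cross_cvg (w w' : R * R -> R * R) (l l' : R * R) :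
      w y @[y --> z] --> l -> w' y @[y --> z] --> l' ->
      cross (w y) (w' y) @[y --> z] --> cross l l'.
    move=> wl wl'.
    apply: cvgB; apply: cvgM.
    + by apply: continuous_cvg wl; exact: cvg_fst.
    + by apply: continuous_cvg wl'; exact: cvg_snd.
    + by apply: continuous_cvg wl; exact: cvg_snd.
    + by apply: continuous_cvg wl'; exact: cvg_fst.
  have zp : y - p @[y --> z] --> z - p by apply: cvgB; [exact: cvg_id|exact: cvg_cst].
  have cu : cst u y @[y --> z] --> u by exact: cvg_cst.
  have cv : cst v y @[y --> z] --> v by exact: cvg_cst.
  apply: cvg_re_exp_deriv; first exact: slit.
    apply: cvgD; first exact: cvg_cst.
    apply: cvgMr; apply: cvgMl; apply: cvgD.
      exact: cross_cvg zp cv.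
    exact: cross_cvg cu zp.
  apply: cvgMl; apply: cvgB.
    exact: cross_cvg zp cv.
  exact: cross_cvg cu zp.
- have nu : dot n u <= 0.
    by apply: (@half_plane_direction _ n p u c) => y hy; apply/Kn/sub; left.
  have nv : dot n v <= 0.
    by apply: (@half_plane_direction _ n p v c) => y hy; apply/Kn/sub; right.
  have [l l0 cl] := cone_opposite_ray p uv0 c n0 nu nv.
  exists (p - l *: (u + v)); first by move=> /Kn; rewrite /half_plane/= leNgt cl.
  (* On the positive axis the argument is 0, so f reduces to - M rho r^-2 times a positive
     number. *)
  have yE : cone_y p u v (p - l *: (u + v)) = 0.
    by rewrite /cone_y /cone_dy /cross /= /GRing.scale /=; ring.
  have xE : cone_x p u v k (p - l *: (u + v)) = 1 + 2 * k * l.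
    move: uv0; rewrite /cone_x /cone_dx /cross => d0.
    by rewrite /= /GRing.scale /=; field.
  have x0 : 0 < 1 + 2 * k * l by have := mulr_gt0 k0 l0; lra.
  rewrite /f yE xE /re_exp_deriv /im_exp /re_exp /re_pow /im_pow /argument.
  rewrite mul0r atan0 !mulr0 sin0 cos0 !mulr0 sin0 cos0 !mulr1 mulr0 oppr0 !mulr0 subr0.
  rewrite mul0r addr0.
  have r0 : 0 < modulus (1 + 2 * k * l) 0.
    exact: lt_le_trans x0 (le_trans (ler_norm _) (normr_le_modulus _ _)).
  rewrite mulr0 addr0 mulNr mulNr oppr_eq0 gt_eqF//.
  apply: mulr_gt0; first by apply: divr_gt0; [exact: mulr_gt0|rewrite exprn_gt0].
  by apply: mulr_gt0 => //; apply: mulr_gt0; exact: expR_gt0.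
- exact: C0.
- move=> z Kz; have sz := sec z Kz.
  apply: le_trans (normr_re_exp_deriv_le rho0 thpi (ltW T1) rth M0 sz) _.
  apply: ler_wpM2l; first exact: ltW.
  rewrite ler_expR !mulNr lerN2 MD.
  have r0 := modulus_gt0 (slit z Kz).
  have h1 : enorm z `^ rho <= D `^ rho * modulus_pow rho (cone_x p u v k z) (cone_y p u v z).
    apply: le_trans (_ : (D * modulus (cone_x p u v k z) (cone_y p u v z)) `^ rho <= _).
      apply: ge0_ler_powR; rewrite ?nnegrE ?sqrtr_ge0 ?mulr_ge0 ?(ltW rho0) ?(ltW r0)//.
      exact: enorm_le_modulus.
    by rewrite powRM ?(ltW r0)// /modulus_pow /powR (gt_eqF r0).
  apply: le_trans (ler_wpM2l (ltW mu0) h1) _.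
  rewrite mulrA; apply: ler_wpM2r; first exact: expR_ge0.
  lra.
(* The coordinates are affine in z, so the line becomes a line of the sector with the same parameter
   t. *)
- move=> q w w1 lK; rewrite /line_integral.
  under eq_integral => t _.
    rewrite /f cone_x_line cone_y_line; over.
  apply: (integral_re_exp_deriv_line rho0 thpi (ltW T1) rth M0) => //.
  + by apply: cone_direction_gt0 => //; exact: enorm1_neq0.
  + by rewrite MD lerDr.
  + move=> t; rewrite -cone_x_line -cone_y_line; apply: sec; apply: lK.
    by exists t.
Qed.

Lemma parallel_exterior_null (R : realType) (K : set (R * R)) (p u n : R * R)
    (c mu eps : R) : u != 0 -> line p u `<=` K -> n != 0 -> K `<=` half_plane n c ->
    0 < mu -> 0 < eps -> eps < 1 ->
  exterior_null_function K mu eps.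
Proof.
move=> u0 lK n0 Kn mu0 eps0 eps1.
have rho01 : 0 <= 1 - eps <= 1 by apply/andP; split; lra.
have [C C0 decay] := gaussian_dipole_decay u rho01 mu0.
exists (gaussian_dipole u), C; split=> //.
- by apply: continuous_in_subspaceT => z _; exact: cvg_gaussian_dipole.
(* The half-plane contains a full line of direction u, so both u and - u have nonpositive product
   with n. *)
- have nu : dot n u = 0.
    apply/eqP; rewrite eq_le -[X in _ && X]oppr_le0; apply/andP; split.
      by apply: (@half_plane_direction _ n p u c) => _ [t _ <-]; apply/Kn/lK; exists t.
    rewrite -mulN1r -dotZr scaleN1r.
    apply: (@half_plane_direction _ n p (- u) c) => _ [t _ <-].
    by apply/Kn/lK; exists (- t); rewrite // scaleNr scalerN.
  have nn := dot_gt0 n0; have uu := dot_gt0 u0.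
  (* The first summand has product c + 1 with n, beyond the half-plane; adding u leaves this
     unchanged and makes the product with u equal to |u|^2. *)
  exists (((c + 1) / dot n n) *: n + u).
    move=> /Kn; rewrite /half_plane/= dotDr dotZr nu addr0 divfK ?gt_eqF//; lra.
  rewrite mulf_neq0 ?gt_eqF ?expR_gt0// dotDr dotZr.
  have -> : dot u n = 0 by rewrite -nu /dot; ring.
  by rewrite mulr0 add0r.
- move=> q w w1 qK.
  (* A line not parallel to u would meet the full line contained in K. *)
  have uw : cross w u = 0.
    apply/eqP; apply: contrapT => /negP wu0.
    have [t [s e]] := lines_meet q p wu0.
    by apply: (qK (q + t *: w)); [exists t|rewrite e; apply: lK; exists s].
  have w0 := enorm1_neq0 w1.
  have uE := cross_eq0_colinear w0 uw; rewrite uE.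
  apply: integral_gaussian_dipole_line => //.
  by apply: contra u0 => /eqP e; rewrite uE e scale0r.
Qed.

Theorem mainTheorem3 (R : realType) (K : set (R * R))
    (Kclosed : closed K) (Kconvex : convex_set K) (Khyp : hyperbolic_type K)
    (mu eps : R) (mu_gt0 : 0 < mu) (eps_gt0 : 0 < eps) (eps_lt1 : eps < 1) :
  exists (f : R * R -> R) (C : R),
    [/\ {within ~` K, continuous f},
        exists2 x, (~` K) x & f x != 0,
        0 < C,
        forall x, (~` K) x -> `|f x| <= C * expR (- mu * (enorm x `^ (1 - eps))) &
        forall p u : R * R, enorm u = 1 -> line p u `<=` ~` K ->
          line_integral f p u = 0%E].
Proof.
case: Khyp => -[p [u [v [u0 v0 uv sub]]]] [A [n [n' [c [c' [n1 _ _ AE]]]]] KA].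
have n0 := enorm1_neq0 n1.
have Kn : K `<=` half_plane n c by move=> z /KA; rewrite AE => -[].
(* For parallel directions the two distinct half-lines are opposite and fill a line. *)
have [uv0|uv0] := eqVneq (cross u v) 0.
  exact: (parallel_exterior_null u0 (full_line_sub u0 uv0 v0 uv sub) n0 Kn).
exact: (transverse_exterior_null uv0 Kconvex sub n0 Kn).
Qed.
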